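(* Let $p$ be a prime, and let $a,n\in\mathbb Z^+$ with $n\ge p^{a-1}$. (i) For any $r\in\mathbb Z$ we have $$F_{p^a}(n,r)\equiv\sum_{k=0}^{d}\binom{r+k-1}{k}F_{p^a}(n+k,0)\pmod p,$$ where $d=\{p^{a-1}-1-n\}_{\varphi(p^a)}$ is the least nonnegative integer with $n+d\equiv p^{a-1}-1\pmod{\varphi(p^a)}$. (ii) We have $$\mathrm{ord}_p\bigl(C_{p^a}(n,r)\bigr)=\left\lfloor\frac{n-p^{a-1}}{\varphi(p^a)}\right\rfloor\quad(\text{i.e., } p\nmid F_{p^a}(n,r))\quad\text{for some } r\in\mathbb Z.$$ If $n\ge 2p^{a-1}$, then $$F_{p^a}\bigl(n+p^a(p-1),r\bigr)\equiv F_{p^a}(n,r)\pmod p\quad\text{for all } r\in\mathbb Z.$$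
   Context: $\mathbb Z^+=\{1,2,\ldots\}$, $\mathbb N=\{0,1,2,\ldots\}$. For $b\in\mathbb Z$ and a positive integer $m$, $\{b\}_m$ denotes the least nonnegative residue of $b$ modulo $m$. $\varphi$ is Euler's totient function, and $\mathrm{ord}_p$ is the $p$-adic order. Binomial coefficients are generalized: $\binom{x}{k}=x(x-1)\cdots(x-k+1)/k!$ with $\binom x0=1$. For $m\in\mathbb Z^+$, $n\in\mathbb N$, $r\in\mathbb Z$, put $C_m(n,r)=\sum_{0\le k\le n,\ k\equiv r\,(\mathrm{mod}\ m)}\binom nk(-1)^k$. For a prime $p$, $a\in\mathbb Z^+$, $n\in\mathbb N$ and $r\in\mathbb Z$, the generalized Fleck quotient is $$F_{p^a}(n,r)=(-p)^{-\lfloor(n-p^{a-1})/\varphi(p^a)\rfloor}C_{p^a}(n,r)+[\![n<p^{a-1}]\!],$$ where $[\![A]\!]$ is $1$ if the assertion $A$ holds and $0$ otherwise; it is an integer (Weisman). *)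

(* Defs.v *)
From HB Require Import structures.
From mathcomp Require Import all_boot all_order all_algebra.

Set Implicit Arguments.
Unset Strict Implicit.
Unset Printing Implicit Defensive.

Import Order.TTheory GRing.Theory Num.Theory.
Local Open Scope ring_scope.

Definition fleck_sum (m n : nat) (r : int) : int :=
  \sum_(0 <= k < n.+1 | (k%:Z == r %[mod m%:Z])%Z) ('C(n, k))%:Z * (-1) ^+ k.

(* [divz] by a positive divisor rounds towards -oo, so this is a genuine floor
   even when n < p ^ (a - 1). *)
Definition fleck_exp (p a n : nat) : int :=
  ((n%:Z - (p ^ a.-1)%N%:Z) %/ (totient (p ^ a))%:Z)%Z.

(* The quotient is taken in rat, with an integer (possibly negative) exponent;
   that its values are integers is a theorem of Weisman. *)
Definition fleck_quo (p a n : nat) (r : int) : rat :=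
  (- p%:R) ^ (- fleck_exp p a n) * (fleck_sum (p ^ a) n r)%:~R
  + (n < p ^ a.-1)%N%:R.

Definition gbinom (x : rat) (k : nat) : rat :=
  (\prod_(i < k) (x - i%:R)) / (k`!)%:R.

(* Congruence and non-divisibility of rationals that are integer-valued;
   integrality is part of the assertion. *)
Definition eqmodQ (m : nat) (x y : rat) : Prop :=
  exists u v : int, [/\ x = u%:~R, y = v%:~R & (u = v %[mod m%:Z])%Z].

Definition ndvdQ (m : nat) (x : rat) : Prop :=
  exists2 u : int, x = u%:~R & ~~ (m%:Z %| u)%Z.

(* ord_p(x) = e for an integer x; ord_p(0) = +oo is never an integer e, whereas
   logn p 0 = 0. *)
Definition ord_eq (p : nat) (x e : int) : Prop :=
  x != 0 /\ (logn p `|x|%N)%:Z = e.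

(* Main.v *)
Require Import Defs.
From HB Require Import structures.
From mathcomp Require Import all_boot all_order all_algebra.
From mathcomp Require Import zify ring.
Import Order.TTheory GRing.Theory Num.Theory.
Local Open Scope ring_scope.

(** Write q = p^a, N = p^(a-1), phi = N(p-1), y = 1 - x, and let Phi(x) be the sum
of x^(jN) for j < p.  The numbers C_q(n,r) are the coefficients of y^n modulo
x^q - 1.  Over Z, y^N = 1 - x^N + p h with h(1) = 0, y^phi = Phi + p g with
g(1) = -1, and p - Phi = (1 - x^N) U.  Since (1 - x^N) Phi = 1 - x^q dies,
multiplying p y^n = Phi y^n + (p - Phi) y^n out gives, for n = N + phi e + s,
  p C_q(n,r) = C_N(n,r) + p^(e+1) [x^r] y^s g^e (1 - x^N)(1 + h U).
By induction on a this yields Weisman's divisibility; moreover the term C_N is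
negligible mod p when n is at least 2N or s = phi - 1.  As 1 - x^q = y^q mod p,
for s = phi - 1 only the constants g(1) and h(1) matter and F_q(n,r) = 1 mod p
for every r; (i) and the nonvanishing in (ii) follow from
F(n+1,r) = F(n,r) - F(n,r-1) by descending from that row.
The periodicity holds because y^phi divides (-g)^p - 1 = -(g+1)^p mod p.
The lemmas shift a by one: there N = p^a and q = p^(a+1). *)

(** * Sums of coefficients over a residue class *)

(** This is the coefficient of [x^r] in the image of [P] modulo [x^m - 1]. Being linear in [P], it
    turns polynomial identities into identities of Fleck sums. *)
Definition residue_sum {R : comNzRingType} (m : nat) (r : int) (P : {poly R}) : R :=
  \sum_(i < size P) P`_i * (m%:Z %| i%:Z - r)%Z%:R.

Lemma residue_sum_widen {R : comNzRingType} (m : nat) (r : int) (P : {poly R}) n :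
  (size P <= n)%N ->
  residue_sum m r P = \sum_(i < n) P`_i * (m%:Z %| i%:Z - r)%Z%:R.
Proof.
move=> le_Pn; rewrite /residue_sum.
rewrite (big_ord_widen n (fun i : nat => P`_i * (m%:Z %| i%:Z - r)%Z%:R)) //.
rewrite big_mkcond /=; apply: eq_bigr => i _.
by case: ltnP => // /(nth_default 0) ->; rewrite mul0r.
Qed.

Lemma residue_sum_is_scalar {R : comNzRingType} (m : nat) (r : int) :
  scalar (@residue_sum R m r).
Proof.
move=> a P Q; set n := maxn (size (a *: P + Q)) (maxn (size P) (size Q)).
rewrite !(@residue_sum_widen _ _ _ _ n) ?leq_max ?leqnn ?orbT //.
rewrite mulr_sumr -big_split /=; apply: eq_bigr => i _.
by rewrite coefD coefZ mulrDl mulrA.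
Qed.

HB.instance Definition _ (R : comNzRingType) (m : nat) (r : int) :=
  GRing.isLinear.Build R {poly R} R *%R (@residue_sum R m r)
    (residue_sum_is_scalar m r).

Lemma residue_sum_natl {R : comNzRingType} m r k (P : {poly R}) :
  residue_sum m r (k%:R * P) = k%:R * residue_sum m r P.
Proof. by rewrite !mulr_natl linearMn. Qed.

Lemma residue_sumXn {R : comNzRingType} m r k :
  residue_sum m r ('X^k : {poly R}) = (m%:Z %| k%:Z - r)%Z%:R.
Proof.
rewrite /residue_sum size_polyXn big_ord_recr /= coefXn eqxx mul1r big1 ?add0r //.
by move=> i _; rewrite coefXn ltn_eqF ?mul0r.
Qed.

Lemma residue_sumMXn {R : comNzRingType} m r (P : {poly R}) k :
  residue_sum m r (P * 'X^k) = residue_sum m (r - k%:Z) P.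
Proof.
rewrite -[P]coefK poly_def mulr_suml !linear_sum /=; apply: eq_bigr => i _.
rewrite -scalerAl -exprD !linearZ /= !residue_sumXn.
by congr (_ * (_ %| _)%Z%:R); lia.
Qed.

Lemma residue_sum_congr {R : comNzRingType} (m : nat) (r r' : int) (P : {poly R}) :
  (m%:Z %| r - r')%Z -> residue_sum m r P = residue_sum m r' P.
Proof.
move=> rr'; apply: eq_bigr => i _; congr (_ * _%:R); congr nat_of_bool.
have -> : i%:Z - r' = (i%:Z - r) + (r - r') by ring.
by rewrite [RHS]rpredDr.
Qed.

(** Shifting by [m] fixes the class of [r], so the functional only sees [P] modulo [1 - 'X^m]. *)
Lemma residue_sum_mul_1BXn {R : comNzRingType} m r (P : {poly R}) :
  residue_sum m r ((1 - 'X^m) * P) = 0.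
Proof.
rewrite mulrC mulrBr mulr1 linearB /= residue_sumMXn.
by rewrite (@residue_sum_congr _ _ (r - m%:Z) r) ?subrr // addrAC subrr add0r rpredN.
Qed.

Lemma residue_sum_map (R : comNzRingType) m r (P : {poly int}) :
  residue_sum m r (map_poly (intr : int -> R) P) = (residue_sum m r P)%:~R.
Proof.
rewrite (residue_sum_widen _ _ _ (size P)) ?size_poly //.
rewrite [RHS]rmorph_sum /=; apply: eq_bigr => i _.
by rewrite coef_map intrM rmorph_nat.
Qed.

(** A class modulo [N] is a disjoint union of [p] classes modulo [N * p], and the shifts by [N * j]
    with [j < p] meet each of them once. *)
Lemma residue_sum_coarsen {R : comNzRingType} (N p : nat) r (P : {poly R}) :
  (0 < N)%N -> (0 < p)%N ->
  residue_sum (N * p) r ((\sum_(j < p) 'X^(N * j)) * P) = residue_sum N r P.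
Proof.
move=> N0 p0; rewrite mulr_suml linear_sum /=.
under eq_bigr do rewrite mulrC residue_sumMXn.
rewrite exchange_big /=; apply: eq_bigr => i _.
rewrite -mulr_sumr; congr (_ * _).
case: (boolP (N%:Z %| i%:Z - r)%Z) => [/dvdzP[t it]|Nit]; last first.
  rewrite big1 // => j _; case: (boolP (_ %| _)%Z) => // /dvdzP[t it].
  case/negP: Nit; apply/dvdzP; exists (t * p%:Z - j%:Z).
  have -> : i%:Z - r = t * (N * p)%N%:Z - (N * j)%N%:Z by rewrite -it; ring.
  by rewrite !PoszM; ring.
have jP (j : nat) : ((N * p)%N%:Z %| i%:Z - (r - (N * j)%N%:Z))%Z
                    = (p%:Z %| t + j%:Z)%Z.
  have -> : i%:Z - (r - (N * j)%N%:Z) = N%:Z * (t + j%:Z).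
    by rewrite opprB addrCA addrC it PoszM; ring.
  by rewrite PoszM dvdz_mul2l // eqz_nat -lt0n.
(* The only shift that contributes is [j = - t] modulo [p]. *)
have lt_j : (`|(- t %% p%:Z)%Z| < p)%N by have := ltz_pmod (- t) (_ : 0 < p%:Z); lia.
rewrite (bigD1 (Ordinal lt_j)) //= jP big1 => [|j nj].
  rewrite addr0 gez0_abs ?modz_ge0 ?eqz_nat -?lt0n //.
  by rewrite addrC -[X in (_ %| _ + X)%Z]opprK -eqz_mod_dvd modz_mod eqxx.
rewrite jP; case: (boolP (_ %| _)%Z) => // pj; case/eqP: nj; apply: val_inj => /=.
have : (j%:Z = - t %[mod p%:Z])%Z by apply/eqP; rewrite eqz_mod_dvd opprK addrC.
move=> <-; rewrite modz_nat modn_small //; lia.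
Qed.

(** * Fleck sums, generalized binomials and backward differences *)

Lemma fleck_sumE m n r : fleck_sum m n r = residue_sum m r ((1 - 'X) ^+ n).
Proof.
rewrite /fleck_sum exprBn linear_sum /= big_mkord big_mkcond /=.
apply: eq_bigr => i _; rewrite expr1n mulr1.
have -> : (-1) ^+ i * 'X^i *+ 'C(n, i)
          = ((-1) ^+ i *+ 'C(n, i)) *: 'X^i :> {poly int}.
  by rewrite -scalerMnl -mul_polyC rmorphXn /= rmorphN1.
rewrite linearZ /= residue_sumXn eqz_mod_dvd.
by case: ifP; rewrite ?mulr0 ?mulr1 // -[RHS]mulr_natl natz.
Qed.

Lemma fleck_sumS m n r :
  fleck_sum m n.+1 r = fleck_sum m n r - fleck_sum m n (r - 1).
Proof.
rewrite !fleck_sumE exprSr mulrBr mulr1 linearB /=.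
by rewrite -['X in X in _ - X]expr1 residue_sumMXn.
Qed.

Lemma gbinomS (x : rat) k : gbinom x k.+1 = gbinom x k * ((x - k%:R) / k.+1%:R).
Proof.
rewrite /gbinom big_ord_recr /= factS natrM invfM.
ring.
Qed.

Lemma gbinomS1 (x : rat) k : gbinom (x + 1) k.+1 = gbinom x k * ((x + 1) / k.+1%:R).
Proof.
rewrite /gbinom big_ord_recl /= factS natrM invfM subr0.
have -> : \prod_(i < k) (x + 1 - (bump 0 i)%:R) = \prod_(i < k) (x - i%:R).
  by apply: eq_bigr => i _; rewrite /bump add1n -[i.+1%:R]natr1; ring.
ring.
Qed.

Lemma gbinom_pascal (x : rat) k :
  gbinom (x + 1) k.+1 = gbinom x k.+1 + gbinom x k.
Proof.
rewrite gbinomS1 gbinomS -{3}[gbinom x k]mulr1 -mulrDr; congr (_ * _).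
have k0 : k.+1%:R != 0 :> rat by rewrite pnatr_eq0.
by apply: (mulIf k0); rewrite [RHS]mulrDl !divfK // mul1r -natr1; ring.
Qed.

Lemma gbinom_nat_lt (n k : nat) : (n < k)%N -> gbinom n%:R k = 0.
Proof.
move=> ltnk; rewrite /gbinom (bigD1 (Ordinal ltnk)) //= subrr !mul0r //.
Qed.

(** Pascal's rule carries integrality from [x = 0] upwards and downwards, once it is known for the
    preceding [k]. *)
Lemma gbinom_int (x : int) k : gbinom x%:~R k \is a Num.int.
Proof.
elim: k x => [|k IHk] x; first by rewrite /gbinom big_ord0 divr1.
elim/int_ind: x => [|n IH|n IH]; first by rewrite (gbinom_nat_lt 0).
- by rewrite -addn1 PoszD intrD gbinom_pascal rpredD.
- have := gbinom_pascal (- n.+1%:Z)%:~R k.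
  have -> : (- n.+1%:Z)%:~R + 1 = (- n%:Z)%:~R :> rat.
    by rewrite -[1]/(1%:~R) -rmorphD; congr (_%:~R); lia.
  move=> E; have : gbinom (- n.+1%:Z)%:~R k.+1 + gbinom (- n.+1%:Z)%:~R k \is a Num.int.
    by rewrite -E.
  by rewrite rpredDr.
Qed.

(* If [x] is the shift [r -> r - 1], this is the expansion of
   [x^-r = (1 - (1 - x))^-r], truncated since [(1 - x)^(d+1)] kills [F n]. *)
Lemma backward_difference_expansion (R : comNzRingType) (F : nat -> int -> R)
    (b : int -> nat -> int) (n d : nat) :
  (forall r, b r 0%N = 1) -> (forall k, b 0 k.+1 = 0) ->
  (forall r k, b r k.+1 = b (r - 1) k.+1 + b r k) ->
  (forall k, (k < d)%N -> forall r, F (n + k).+1 r = F (n + k)%N r - F (n + k)%N (r - 1)) ->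
  (forall r, F (n + d)%N r = F (n + d)%N 0) ->
  forall r, F n r = \sum_(0 <= k < d.+1) (b r k)%:~R * F (n + k)%N 0.
Proof.
move=> b0 b00 bS; elim: d n => [|d IHd] n FS Fd r.
  by rewrite big_nat1 b0 mul1r addn0; have := Fd r; rewrite addn0.
have {}IHd : forall r, F n.+1 r = \sum_(0 <= k < d.+1) (b r k)%:~R * F (n.+1 + k)%N 0.
  apply: IHd => [k kd r'|r']; first by have := FS k.+1 kd r'; rewrite addnS.
  by have := Fd r'; rewrite addnS.
(* The right-hand side [G] has the same backward differences in [r] as [F n] and the same value at
   0, so induction in both directions identifies them. *)
pose G r := \sum_(0 <= k < d.+2) (b r k)%:~R * F (n + k)%N 0.
have GS r' : G r' - G (r' - 1) = F n r' - F n (r' - 1).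
  have := FS 0%N isT r'; rewrite addn0 => <-; rewrite IHd /G.
  rewrite -sumrB big_nat_recl //= !b0 subrr add0r; apply: eq_bigr => k _.
  by rewrite -mulrBl -intrB bS addrC addKr addSnnS.
have G0 : G 0 = F n 0.
  rewrite /G big_nat_recl // b0 mul1r addn0 big1 ?addr0 // => k _.
  by rewrite b00 mul0r.
rewrite -/(G r); elim/int_ind: r => // k IHk.
  have := GS k.+1; have -> : k.+1%:Z - 1 = k by lia.
  by rewrite IHk => /addIr.
have := GS (- k%:Z); have -> : - k%:Z - 1 = - k.+1%:Z by lia.
by rewrite IHk => /addrI/oppr_inj.
Qed.

(** * Polynomials modulo [p] and lifts of powers of [1 - 'X] *)

Local Notation "P ^Fp p" := (map_poly (intr : int -> 'F_p) P) (at level 2).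

Lemma pchar_polyFp {p : nat} : prime p -> p \in [pchar {poly 'F_p}].
Proof. by move/pchar_Fp; apply: (rmorph_pchar polyC). Qed.

Lemma exprBX_pchar {R : comNzRingType} {p : nat} (x y : R) a :
  p \in [pchar R] -> (x - y) ^+ (p ^ a) = x ^+ (p ^ a) - y ^+ (p ^ a).
Proof.
move=> pR; have pn : [pchar R].-nat (p ^ a)%N.
  by rewrite pnatX pnatE ?(pcharf_prime pR) ?pR.
by rewrite exprDn_pchar // exprNn_pchar.
Qed.

Lemma exp_1BX_Fp {p : nat} a : prime p ->
  (1 - 'X) ^+ (p ^ a) = 1 - 'X^(p ^ a) :> {poly 'F_p}.
Proof. by move/pchar_polyFp/exprBX_pchar ->; rewrite expr1n. Qed.

Lemma poly_Fp_eq0 {p : nat} {P : {poly int}} :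
  prime p -> P^Fp p = 0 -> exists Q, P = p%:R * Q.
Proof.
move=> pp P0; exists (\poly_(i < size P) (P`_i %/ p%:Z)%Z).
apply/polyP => i; rewrite mulr_natl coefMn coef_poly.
case: ltnP => [_|/(nth_default 0) ->]; last by rewrite mul0rn.
have : (p%:Z %| P`_i)%Z.
  by rewrite (dvdz_pcharf (pchar_Fp pp)) -coef_map P0 coef0.
by rewrite dvdz_eq => /eqP {1}<-; rewrite -mulr_natr natz.
Qed.

Lemma map_poly_Fp_p {p : nat} (P : {poly int}) : prime p -> (p%:R * P)^Fp p = 0.
Proof.
by move=> pp; rewrite rmorphM /= rmorph_nat (pcharf0 (pchar_polyFp pp)) mul0r.
Qed.

Lemma map_poly_Fp_1BX p : (1 - 'X)^Fp p = 1 - 'X.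
Proof. by rewrite rmorphB rmorph1 /= map_polyX. Qed.

Lemma map_poly_Fp_1BXn p n : (1 - 'X^n)^Fp p = 1 - 'X^n.
Proof. by rewrite rmorphB rmorph1 /= map_polyXn. Qed.

(** For [p] prime and [N] a power of [p] this is the cyclotomic polynomial of order [N * p]; for
    [N = 1] it is a full geometric sum. *)
Definition cyclo {R : comNzRingType} (p N : nat) : {poly R} :=
  \sum_(j < p) 'X^(N * j).

Lemma mul_1BXn_cyclo {R : comNzRingType} p N :
  (1 - 'X^N) * cyclo p N = 1 - 'X^(N * p) :> {poly R}.
Proof.
rewrite exprM -[RHS]opprB subrX1 -mulNr opprB; congr (_ * _).
by apply: eq_bigr => j _; rewrite exprM.
Qed.

Lemma natr_sub_cyclo {R : comNzRingType} p N :
  exists U : {poly R}, p%:R - cyclo p N = (1 - 'X^N) * U.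
Proof.
exists (\sum_(j < p) \sum_(i < j) 'X^N ^+ i).
rewrite mulr_sumr -[p in p%:R]card_ord -sumr_const -sumrB.
apply: eq_bigr => j _; rewrite exprM -[LHS]opprB subrX1.
by rewrite -mulNr opprB.
Qed.

Lemma horner_1BX n : (0 < n)%N -> ((1 - 'X : {poly int}) ^+ n).[1] = 0.
Proof. by move=> n0; rewrite !hornerE subrr expr0n gtn_eqF. Qed.

(** Frobenius gives the congruence modulo [p]; all other terms vanish at 1, hence so does [h]. *)
Lemma exp_1BX_lift p a : prime p -> exists2 h : {poly int},
  (1 - 'X) ^+ (p ^ a) = 1 - 'X^(p ^ a) + p%:R * h & h.[1] = 0.
Proof.
move=> pp; have p0 := prime_gt0 pp.
have [|h hE] := @poly_Fp_eq0 p ((1 - 'X) ^+ (p ^ a) - (1 - 'X^(p ^ a))) pp.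
  by rewrite rmorphB rmorphXn /= map_poly_Fp_1BX map_poly_Fp_1BXn exp_1BX_Fp ?subrr.
exists h; first by rewrite -hE [RHS]addrC subrK.
have /eqP := congr1 (horner^~ 1) hE.
rewrite mulr_natl hornerMn hornerD horner_1BX ?expn_gt0 ?p0 // !hornerE expr1n.
by rewrite subrr oppr0 eq_sym mulrn_eq0 gtn_eqF //= => /eqP.
Qed.

Lemma exp_1BX_cyclo p a : prime p -> exists2 g : {poly int},
  (1 - 'X) ^+ (p ^ a * (p - 1)) = cyclo p (p ^ a) + p%:R * g & g.[1] = -1.
Proof.
move=> pp; have p0 := prime_gt0 pp; have p1 := prime_gt1 pp.
have [|g gE] := @poly_Fp_eq0 p ((1 - 'X) ^+ (p ^ a * (p - 1)) - cyclo p (p ^ a)) pp.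
  apply/eqP; rewrite rmorphB rmorphXn /= map_poly_Fp_1BX subr_eq0; apply/eqP.
  (* The congruence is checked after multiplication by [(1 - 'X) ^+ (p ^ a)], when both sides become
     [1 - 'X^(p ^ a.+1)]. *)
  have X0 : (1 - 'X) ^+ (p ^ a) != 0 :> {poly 'F_p}.
    by rewrite expf_neq0 // -oppr_eq0 opprB -polyC1 polyXsubC_eq0.
  apply: (mulfI X0).
  rewrite -exprD exp_1BX_Fp // /cyclo rmorph_sum /=.
  under eq_bigr do rewrite map_polyXn.
  rewrite -/(cyclo p (p ^ a)) mul_1BXn_cyclo -mulnS subn1 prednK // -expnSr.
  by rewrite exp_1BX_Fp.
exists g; first by rewrite -gE [RHS]addrC subrK.
(* At 1 the power vanishes and [cyclo] takes the value [p], which forces [g.[1] = -1]. *)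
have := congr1 (horner^~ 1) gE.
rewrite mulr_natl hornerMn hornerD horner_1BX ?muln_gt0 ?subn_gt0 ?p1 ?expn_gt0 ?p0 // add0r hornerN.
rewrite /cyclo horner_sum.
under eq_bigr do rewrite hornerXn expr1n.
rewrite sumr_const card_ord -mulNrn => /esym/eqP.
by rewrite -subr_eq0 -mulrnBl mulrn_eq0 gtn_eqF //= subr_eq0 => /eqP.
Qed.

(* Here [-g] is the image of [(1 - zeta)^phi / (-p)], a unit of [Z[zeta]] for a
   primitive [p^(a+1)]-th root of unity [zeta]. *)
Lemma fleck_split p a : prime p -> exists g w h : {poly int},
  [/\ (1 - 'X) ^+ (p ^ a * (p - 1)) = cyclo p (p ^ a) + p%:R * g,
      (1 - 'X) ^+ (p ^ a) = 1 - 'X^(p ^ a) + p%:R * h,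
      g.[1] = -1, h.[1] = 0 & w.[1] = 1] /\
  forall e s r, let n := (p ^ a + p ^ a * (p - 1) * e + s)%N in
    p%:Z * fleck_sum (p ^ a.+1) n r = fleck_sum (p ^ a) n r
      + p%:Z ^+ e.+1 * residue_sum (p ^ a.+1) r
                         ((1 - 'X) ^+ s * g ^+ e * ((1 - 'X^(p ^ a)) * w)).
Proof.
move=> pp; have p0 := prime_gt0 pp.
have [h hE h1] := exp_1BX_lift p a pp; have [g gE g1] := exp_1BX_cyclo p a pp.
have [U UE] := @natr_sub_cyclo int p (p ^ a).
exists g, (1 + h * U), h; split; first by rewrite !hornerE h1 mul0r addr0.
move=> e s r n.
have := subrXX ((1 - 'X) ^+ (p ^ a * (p - 1))) (p%:R * g) e.
rewrite {2}gE addrK; set T := \sum_(i < e) _ => TE.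
set S := (1 - 'X) ^+ s; set B := 1 - 'X^(p ^ a); pose C : {poly int} := cyclo p (p ^ a).
set G := (p%:R * g) ^+ e in TE.
have BC : 1 - 'X^(p ^ a.+1) = B * C by rewrite mul_1BXn_cyclo -expnSr.
have pE : p%:R = C + B * U by rewrite -UE [RHS]addrC subrK.
have YE : (1 - 'X) ^+ n = (B + p%:R * h) * (G + C * T) * S.
  by rewrite -TE [G + _]addrC subrK -hE -exprM -!exprD.
(* Since [B * U = p - C], the product [B * U * (B + p * h)] equals [p * B * (1 + h * U) - B * C],
   and [B * C] is [1 - 'X^(p ^ a.+1)]. *)
have key : p%:R * (1 - 'X) ^+ n
    = C * (1 - 'X) ^+ n + p%:R ^+ e.+1 * (S * g ^+ e * (B * (1 + h * U)))
      + (1 - 'X^(p ^ a.+1)) * (U * (B + p%:R * h) * T * S - G * S).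
  have -> : p%:R ^+ e.+1 * (S * g ^+ e * (B * (1 + h * U)))
            = p%:R * G * S * (B * (1 + h * U)).
    rewrite /G exprMn exprS; move: (p%:R) (_ ^+ e) (g ^+ e) => c c' g'.
    by clearbody S B; clear; ring.
  rewrite YE BC pE; clearbody S B C T G; clear; ring.
have := congr1 (residue_sum (p ^ a.+1) r) key.
rewrite !linearD /= residue_sum_mul_1BXn addr0 expnSr residue_sum_coarsen ?expn_gt0 ?p0 //.
rewrite -expnSr !fleck_sumE -natrX !residue_sum_natl.
by rewrite natrX !natz.
Qed.

(** * Weisman's divisibility, and [g] and [h] modulo [p] *)

Lemma fleck_sum1 n r : (0 < n)%N -> fleck_sum 1 n r = 0.
Proof. by case: n => // n _; rewrite fleck_sumE exprS -['X]expr1 residue_sum_mul_1BXn. Qed.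

(** By [fleck_split], divisibility by [p ^ w] follows from divisibility by [p ^ w.+1] one level
    lower, and at the bottom [fleck_sum 1 n r] vanishes. *)
Lemma fleck_sum_dvd p a n w r : prime p ->
  (p ^ a * (1 + (p - 1) * w) <= n)%N ->
  (p%:Z ^+ w %| fleck_sum (p ^ a.+1) n r)%Z.
Proof.
move=> pp; have p1 := prime_gt1 pp.
have p0 : p%:Z != 0 by rewrite eqz_nat -lt0n; lia.
move: n w; have step b n w : (p ^ b * (1 + (p - 1) * w) <= n)%N ->
    (p%:Z ^+ w.+1 %| fleck_sum (p ^ b) n r)%Z ->
    (p%:Z ^+ w %| fleck_sum (p ^ b.+1) n r)%Z.
  move=> le_n Cb; have [g [x [h [_ Hsplit]]]] := fleck_split p b pp.
  have := Hsplit w (n - p ^ b * (1 + (p - 1) * w))%N r.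
  rewrite -[X in (X + _ * _ * _ + _)%N]muln1 -mulnA -mulnDr subnKC // => Cn.
  by rewrite -(dvdz_mul2l p0) -exprS Cn rpredD ?dvdz_mulr.
elim: a => [|a IHa] n w le_n; apply: step => //.
  by rewrite fleck_sum1 ?dvdz0 //; lia.
(* The bound for [w + 1] one level lower follows from [1 + (p - 1) * (w + 1) <= p * (1 + (p - 1) *
   w)]. *)
apply: IHa; apply: leq_trans le_n; rewrite expnSr -mulnA leq_mul2l.
by case: (p) p1 => // k _; rewrite subn1 /= mulnS !mulSn; lia.
Qed.

(* For [a > 0], [h = x^L (1 - x)^L] mod 2 with [L = 2^(a-1)]: for p = 2 only this
   vanishing of [h] at 1, doubled by squaring, is available in the next lemma. *)
Lemma sqr_defect_Fp2 {a : nat} {h : {poly int}} :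
  (1 - 'X) ^+ (2 ^ a) = 1 - 'X^(2 ^ a) + 2%:R * h ->
  (1 - 'X) ^+ (2 ^ a) %| h^Fp 2 ^+ 2.
Proof.
have two0 : 2%:R != 0 :> {poly int} by rewrite -polyC_natr polyC_eq0.
case: a => [|a] hE.
  suff -> : h = 0 by rewrite rmorph0 expr0n dvdp0.
  apply: (mulfI two0); apply: (addrI (1 - 'X)).
  by rewrite mulr0 addr0 -['X in LHS]expr1 -[1%N]/(2 ^ 0)%N -hE.
(* Squaring the lift at level [a] yields [h] explicitly. *)
have [k kE _] := exp_1BX_lift 2 a (isT : prime 2).
have {hE} -> : h = - ('X^(2 ^ a) * (1 - 'X^(2 ^ a))) + 2%:R * (k ^+ 2 + k * (1 - 'X^(2 ^ a))).
  apply: (mulfI two0); apply: (addrI (1 - 'X^(2 ^ a.+1))).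
  rewrite -hE expnSr !exprM kE; clear; move: 'X^_ => x; ring.
rewrite rmorphD /= map_poly_Fp_p // addr0 rmorphN sqrrN rmorphM /=.
rewrite map_poly_Fp_1BXn exprMn -exp_1BX_Fp // -exprM -expnSr.
exact: dvdp_mull.
Qed.

(* With [g1] the polynomial [g] for modulus [p], [g(x) - g1(x^N) = h S] where
   [S = (p - 1) (1 - x)^(N (p - 2))] mod p, and [1 - x^N] divides [g1(x^N) + 1]. *)
Lemma dvdp_g1_Fp {p a : nat} {g h : {poly int}} : prime p ->
  (1 - 'X) ^+ (p ^ a * (p - 1)) = cyclo p (p ^ a) + p%:R * g ->
  (1 - 'X) ^+ (p ^ a) = 1 - 'X^(p ^ a) + p%:R * h ->
  (1 - 'X) ^+ (p ^ a * (p - 1)) %| (g^Fp p + 1) ^+ p.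
Proof.
move=> pp gE hE; have p0 : p%:R != 0 :> {poly int}.
  by rewrite -polyC_natr polyC_eq0 pnatr_eq0 -lt0n prime_gt0.
have [g1 g1E g1r] := exp_1BX_cyclo p 0 pp.
have [k kE] : exists k, g1 + 1 = k * ('X - 1%:P).
  by apply/factor_theorem; rewrite rootE hornerD g1r hornerC addNr.
pose S := \sum_(i < p - 1) ((1 - 'X) ^+ (p ^ a)) ^+ ((p - 1).-1 - i)
                           * (1 - 'X^(p ^ a)) ^+ i : {poly int}.
(* Substituting ['X^(p ^ a)] into the identity for [g1] and subtracting cancels [cyclo]; what
   remains is a difference of [(p - 1)]-th powers, equal to [p * h * S]. *)
have {gE} gE : g + 1 = (1 - 'X^(p ^ a)) * - (k \Po 'X^(p ^ a)) + h * S.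
  have k1 := congr1 (comp_poly ('X^(p ^ a))) kE.
  rewrite comp_polyD comp_polyM comp_polyB comp_polyX !comp_polyC in k1.
  have g2 := congr1 (comp_poly ('X^(p ^ a))) g1E.
  rewrite expn0 mul1n rmorphXn comp_polyD comp_polyM -polyC_natr comp_polyC polyC_natr in g2.
  rewrite /= comp_polyB -[1]polyC1 comp_polyC polyC1 in g2.
  rewrite comp_polyX rmorph_sum /= in g2.
  rewrite (eq_bigr (fun j : 'I_p => 'X^(p ^ a * j))) in g2; last first.
    by move=> j _; rewrite mul1n comp_Xn_poly exprM.
  have {}k1 : g1 \Po 'X^(p ^ a) + 1 = (1 - 'X^(p ^ a)) * - (k \Po 'X^(p ^ a)).
    by rewrite k1 mulrN -mulNr opprB mulrC.
  rewrite -k1; apply: (addIr (-1)); rewrite addrK addrAC addrK.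
  apply: (mulfI p0); rewrite mulrDr.
  apply: (addrI (cyclo p (p ^ a))).
  rewrite -gE addrA /cyclo -g2 exprM mulrA.
  have -> : p%:R * h = (1 - 'X) ^+ (p ^ a) - (1 - 'X^(p ^ a)).
    by rewrite hE [RHS]addrAC subrr add0r.
  by rewrite -subrXX addrC subrK.
have SE : S^Fp p = (p - 1)%:R * (1 - 'X) ^+ (p ^ a * (p - 2)).
  rewrite rmorph_sum /=.
  rewrite (eq_bigr (fun=> (1 - 'X) ^+ (p ^ a * (p - 2)))).
    by rewrite sumr_const card_ord mulr_natl.
  move=> i _; rewrite rmorphM !rmorphXn /= map_poly_Fp_1BX map_poly_Fp_1BXn.
  rewrite -exp_1BX_Fp // -!exprM -exprD -mulnDr; congr (_ ^+ (_ * _)).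
  by have := ltn_ord i; lia.
have -> : g^Fp p + 1 = (g + 1)^Fp p by rewrite rmorphD rmorph1.
rewrite gE rmorphD !rmorphM /= map_poly_Fp_1BXn SE -exp_1BX_Fp //.
(* For [p > 2] both summands contain [(1 - 'X) ^+ (p ^ a)], the second through [S]. For [p = 2], [S]
   is 1 and the factor must come from the square of [h]. *)
case: (ltngtP p 2) => [||p2].
- by have := prime_gt1 pp; lia.
- move=> p2; apply: (@dvdp_trans _ (((1 - 'X) ^+ (p ^ a)) ^+ p)).
    by rewrite -exprM dvdp_exp2l // leq_mul2l leq_subr orbT.
  rewrite dvdp_exp2r // dvdp_add //; first exact: dvdp_mulr.
  by do 2!apply: dvdp_mull; rewrite dvdp_exp2l // leq_pmulr; lia.
subst p; rewrite mul1r muln0 expr0 mulr1 subn1 muln1.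
rewrite (exprDn_pchar _ _ (_ : _.-nat 2)) ?pnatE ?pchar_polyFp //.
by rewrite dvdp_add ?sqr_defect_Fp2 // exprMn dvdp_mulr // dvdp_exp.
Qed.

(** * Normalized Fleck sums modulo [p] *)

(** After division by [p ^ e.+1] in [fleck_split], the lower-level sum is still divisible by [p] and
    drops out. Taking [G = - g] absorbs the sign of [(- p) ^ e] and makes [G.[1] = 1]. *)
Lemma fleck_Fp p a : prime p -> exists G W : {poly 'F_p},
  [/\ G.[1] = 1, W.[1] = 1, (1 - 'X) ^+ (p ^ a * (p - 1)) %| G ^+ p - 1 &
  forall e s r, let n := (p ^ a + p ^ a * (p - 1) * e + s)%N in
    (p%:Z ^+ e.+2 %| fleck_sum (p ^ a) n r)%Z ->
    exists2 z : int, fleck_sum (p ^ a.+1) n r = (- p%:Z) ^+ e * z &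
      z%:~R = residue_sum (p ^ a.+1) r
                ((1 - 'X) ^+ s * G ^+ e * ((1 - 'X) ^+ (p ^ a) * W)) :> 'F_p].
Proof.
move=> pp; have p0 : p%:Z != 0 by rewrite eqz_nat -lt0n prime_gt0.
have [g [w [h [[gE hE g1 h1 w1] Hsplit]]]] := fleck_split p a pp.
have dvd_g := dvdp_g1_Fp pp gE hE.
have eval1 (P : {poly int}) : (P^Fp p).[1] = (P.[1])%:~R.
  by rewrite -(horner_map intr) rmorph1.
have pnat_p : [pchar {poly 'F_p}].-nat p by rewrite pnatE ?pchar_polyFp.
exists (- g^Fp p), (w^Fp p); split.
- by rewrite hornerN eval1 g1 mulrN1z opprK.
- by rewrite eval1 w1.
- rewrite (exprNn_pchar _ pnat_p) -opprD dvdpNr.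
  by move: dvd_g; rewrite (exprDn_pchar _ _ pnat_p) expr1n.
move=> e s r n /dvdzP[k Ck]; have := Hsplit e s r; rewrite /= -/n Ck.
set c := residue_sum _ _ _ => Cn.
have {}Cn : fleck_sum (p ^ a.+1) n r = p%:Z ^+ e * (k * p%:Z + c).
  apply: (mulfI p0); rewrite Cn !exprS; ring.
exists ((-1) ^+ e * (k * p%:Z + c)).
  by rewrite Cn mulrA -exprMn mulrN1 opprK.
have pFp : p%:~R = 0 :> 'F_p by apply: pcharf0 (pchar_Fp pp).
rewrite rmorphM rmorphD rmorphM /= pFp mulr0 add0r rmorphXn /= rmorphN1.
rewrite -residue_sum_map -linearZ /=; congr (residue_sum _ _ _).
rewrite !rmorphM !rmorphXn /= map_poly_Fp_1BX map_poly_Fp_1BXn -exp_1BX_Fp //.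
rewrite [(- g^Fp p) ^+ e]exprNn -mul_polyC rmorphXn /= rmorphN1.
by rewrite !mulrA [_ ^+ s * _]mulrC.
Qed.

(** Over ['F_p] the power is [1 + x + ... + x^(p^a - 1)], in which each class modulo [p ^ a] occurs
    exactly once. *)
Lemma residue_sum_exp_1BX_top p a r : prime p ->
  residue_sum (p ^ a) r ((1 - 'X) ^+ (p ^ a - 1)) = 1 :> 'F_p.
Proof.
move=> pp; have q0 : (0 < p ^ a)%N by rewrite expn_gt0 prime_gt0.
have -> : (1 - 'X) ^+ (p ^ a - 1) = cyclo (p ^ a) 1 :> {poly 'F_p}.
  have X0 : 1 - 'X != 0 :> {poly 'F_p}.
    by rewrite -oppr_eq0 opprB -polyC1 polyXsubC_eq0.
  apply: (mulfI X0); rewrite -exprS subn1 prednK // exp_1BX_Fp //.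
  by have := @mul_1BXn_cyclo 'F_p (p ^ a) 1; rewrite expr1 mul1n => ->.
have := @residue_sum_coarsen 'F_p 1 (p ^ a) r 1 isT q0.
rewrite mulr1 mul1n => ->.
by have := @residue_sumXn 'F_p 1 r 0; rewrite expr0 dvd1z.
Qed.

Lemma residue_sum_dvdp p a r (P : {poly 'F_p}) : prime p ->
  (1 - 'X) ^+ (p ^ a) %| P -> residue_sum (p ^ a) r P = 0.
Proof.
by move=> pp /dvdpP[Q ->]; rewrite exp_1BX_Fp // mulrC residue_sum_mul_1BXn.
Qed.

(** Here [n] is the last row with exponent [e]; the normalized sum does not depend on [r] modulo
    [p], which anchors the descent to earlier rows. *)
Lemma fleck_sum_top p a n e r : prime p ->
  n.+1 = (p ^ a + p ^ a * (p - 1) * e.+1)%N ->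
  exists2 z : int, fleck_sum (p ^ a.+1) n r = (- p%:Z) ^+ e * z & z%:~R = 1 :> 'F_p.
Proof.
move=> pp En; have p1 := prime_gt1 pp.
have N0 : (0 < p ^ a)%N by rewrite expn_gt0 prime_gt0.
have [G [W [G1 W1 _ /(_ e (p ^ a * (p - 1) - 1)%N r)]]] := fleck_Fp p a pp.
have -> : (p ^ a + p ^ a * (p - 1) * e + (p ^ a * (p - 1) - 1))%N = n.
  by rewrite -[n]/(n.+1.-1) En mulnS; have := muln_gt0 (p ^ a) (p - 1); lia.
case.
  case: a En N0 {G1 W1} => [|a] En N0; first by rewrite fleck_sum1 ?dvdz0 //; lia.
  apply: fleck_sum_dvd => //.
  rewrite -ltnS En; move: N0; rewrite expnSr !mulnS mulnDr.
  case: (p) p1 => [|[|k]] // _; rewrite subn1 /= => N0; nia.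
move=> z -> zE; exists z; rewrite // {}zE.
(* Only the value of [G ^+ e * W] at 1 matters: a multiple of ['X - 1] times
   [(1 - 'X) ^+ (p ^ a.+1 - 1)] is killed. *)
have [k kE] : exists k, G ^+ e * W - 1 = k * ('X - 1%:P).
  apply/factor_theorem; rewrite rootE !hornerE.
  by rewrite G1 W1 expr1n mul1r subrr.
have q1 : (p ^ a * (p - 1) - 1 + p ^ a = p ^ a.+1 - 1)%N.
  by rewrite expnSr; case: (p) p1 N0 => // m; rewrite !subn1 mulnS; nia.
rewrite mulrACA mulrA -mulrA -exprD q1 -[G ^+ e * W](subrK 1) kE mulrDr mulr1.
rewrite linearD /= residue_sum_exp_1BX_top // residue_sum_dvdp ?add0r //.
rewrite mulrCA dvdp_mull // -[_ - 1%:P]opprB mulrN dvdpNr polyC1 -exprSr.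
by rewrite subn1 prednK ?expn_gt0 ?prime_gt0.
Qed.

(** The shift of [n] replaces [e] by [e + p], which inserts [G ^+ p]. The factor
    [(1 - 'X) ^+ (p ^ a)] already present completes the one dividing [G ^+ p - 1] to
    [(1 - 'X) ^+ (p ^ a.+1)]. *)
Lemma fleck_sum_period p a e s r : prime p -> (s < p ^ a * (p - 1))%N ->
  let n := (p ^ a + p ^ a * (p - 1) * e + s)%N in
  (2 * p ^ a <= n)%N ->
  exists z z' : int, [/\ fleck_sum (p ^ a.+1) n r = (- p%:Z) ^+ e * z,
    fleck_sum (p ^ a.+1) (n + p ^ a.+1 * (p - 1)) r = (- p%:Z) ^+ (e + p) * z' &
    z%:~R = z'%:~R :> 'F_p].
Proof.
move=> pp lts n le_n; have p1 := prime_gt1 pp.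
have N0 : (0 < p ^ a)%N by rewrite expn_gt0 prime_gt0.
have [G [W [_ _ dvdG HGW]]] := fleck_Fp p a pp.
(* For [e' = 0] and [a > 0], divisibility by [p ^ 2] one level lower asks for
   [(2 * p - 1) * p ^ (a - 1) <= n], whence the bound [2 * p ^ a <= n]. *)
have low e' : (e <= e')%N ->
    (p%:Z ^+ e'.+2 %| fleck_sum (p ^ a) (p ^ a + p ^ a * (p - 1) * e' + s)%N r)%Z.
  move=> lee; have le_n' : (2 * p ^ a <= p ^ a + p ^ a * (p - 1) * e' + s)%N.
    by apply: leq_trans le_n _; rewrite leq_add2r leq_add2l leq_mul2l lee orbT.
  case: a N0 le_n' {HGW dvdG lts le_n n} => [|a] N0 le_n'.
    by rewrite fleck_sum1 ?dvdz0 //; lia.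
  apply: fleck_sum_dvd => //; move: N0 le_n'; rewrite expnSr.
  move: (p ^ a)%N => L; case: (p) p1 => [|[|k]] // _; rewrite subn1 /=.
  case: e' {lee} => [|e']; nia.
have [z zE z1] := HGW e s r (low e (leqnn e)).
have [z' zE' z1'] := HGW (e + p)%N s r (low (e + p)%N (leq_addr p e)).
exists z, z'; split => //.
  rewrite -zE'; congr (fleck_sum _ _ _); rewrite expnSr mulnDr; nia.
apply/eqP; rewrite z1 z1' -subr_eq0 -opprB oppr_eq0 -linearB /= exprD.
rewrite residue_sum_dvdp //.
have -> : (1 - 'X) ^+ s * (G ^+ e * G ^+ p) * ((1 - 'X) ^+ (p ^ a) * W)
    - (1 - 'X) ^+ s * G ^+ e * ((1 - 'X) ^+ (p ^ a) * W)
  = ((1 - 'X) ^+ (p ^ a) * (G ^+ p - 1)) * ((1 - 'X) ^+ s * G ^+ e * W).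
  by move: (_ ^+ s) (_ ^+ (p ^ a)) (G ^+ e) (G ^+ p) => A B C D; clear; ring.
apply: dvdp_mulr; rewrite expnSr -[X in (_ * X)%N](subnKC (ltnW p1)) mulnDr muln1.
by rewrite exprD dvdp_mul.
Qed.

(** * From Fleck sums to Fleck quotients *)

Lemma fleck_sum_integral p a e s r : prime p ->
  exists z, fleck_sum (p ^ a.+1) (p ^ a + p ^ a * (p - 1) * e + s)%N r
            = (- p%:Z) ^+ e * z.
Proof.
move=> pp.
have /dvdzP[k ->] : (p%:Z ^+ e %| fleck_sum (p ^ a.+1) (p ^ a + p ^ a * (p - 1) * e + s)%N r)%Z.
  by apply: fleck_sum_dvd; rewrite // mulnDr muln1 mulnA leq_addr.
exists ((-1) ^+ e * k); rewrite mulrA -exprMn mulrN1 opprK mulrC //.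
Qed.

Lemma eqz_mod_Fp {p : nat} (u v : int) : prime p ->
  u%:~R = v%:~R :> 'F_p -> (u = v %[mod p%:Z])%Z.
Proof.
move=> pp uv; apply/eqP; rewrite eqz_mod_dvd (dvdz_pcharf (pchar_Fp pp)).
by rewrite rmorphB /= uv subrr.
Qed.

Lemma totient_expS {p a : nat} : prime p -> totient (p ^ a.+1) = (p ^ a * (p - 1))%N.
Proof. by move=> pp; rewrite totient_pfactor // mulnC subn1. Qed.

Lemma phi_gt0 {p a : nat} : prime p -> (0 < p ^ a * (p - 1))%N.
Proof. by move=> pp; rewrite -totient_expS // totient_gt0 expn_gt0 prime_gt0. Qed.

Lemma fleck_expE p a e s : prime p -> (s < p ^ a * (p - 1))%N ->
  fleck_exp p a.+1 (p ^ a + p ^ a * (p - 1) * e + s) = e.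
Proof.
move=> pp lts; rewrite /fleck_exp totient_expS //= -addnA PoszD addrC addKr.
by rewrite divz_nat mulnC divnMDl ?phi_gt0 // divn_small // addn0.
Qed.

Lemma fleck_quoE p a e s r z : prime p -> (s < p ^ a * (p - 1))%N ->
  let n := (p ^ a + p ^ a * (p - 1) * e + s)%N in
  fleck_sum (p ^ a.+1) n r = (- p%:Z) ^+ e * z -> fleck_quo p a.+1 n r = z%:~R.
Proof.
move=> pp lts n Cn; rewrite /fleck_quo fleck_expE // Cn ltnNge /n -addnA leq_addr addr0.
rewrite rmorphM rmorphXn /= rmorphN /= -exprnN mulKf //.
by rewrite expf_neq0 // oppr_eq0 pnatr_eq0 -lt0n prime_gt0.
Qed.

Lemma fleck_index {p a n : nat} : prime p -> (p ^ a <= n)%N ->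
  exists e s, (s < p ^ a * (p - 1))%N /\ n = (p ^ a + p ^ a * (p - 1) * e + s)%N.
Proof.
move=> pp le_n; exists ((n - p ^ a) %/ (p ^ a * (p - 1)))%N.
exists ((n - p ^ a) %% (p ^ a * (p - 1)))%N.
by rewrite ltn_mod phi_gt0 // -addnA [(_ * (_ %/ _))%N]mulnC -divn_eq subnKC.
Qed.

Lemma fleck_quo_int p a n r : prime p -> (p ^ a <= n)%N ->
  fleck_quo p a.+1 n r \is a Num.int.
Proof.
move=> pp /(fleck_index pp)[e [s [lts ->]]].
by have [z /(fleck_quoE _ _ _ _ _ _ pp lts) ->] := fleck_sum_integral p a e s r pp.
Qed.

Lemma fleck_quoS p a n r : (p ^ a <= n)%N ->
  fleck_exp p a.+1 n.+1 = fleck_exp p a.+1 n ->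
  fleck_quo p a.+1 n.+1 r = fleck_quo p a.+1 n r - fleck_quo p a.+1 n (r - 1).
Proof.
move=> le_n En; rewrite /fleck_quo En fleck_sumS rmorphB /=.
by rewrite !ltnNge le_n (leq_trans le_n) // !addr0 mulrBr.
Qed.

Theorem theorem1p4 (p a n : nat) (hp : prime p) (ha : (0 < a)%N)
    (hn : (0 < n)%N) (hpn : (p ^ a.-1 <= n)%N) :
  (forall (r : int) (d : nat),
     d%:Z = (((p ^ a.-1)%N%:Z - 1 - n%:Z) %% (totient (p ^ a))%:Z)%Z ->
     eqmodQ p (fleck_quo p a n r)
       (\sum_(0 <= k < d.+1)
          gbinom (r%:~R + k%:R - 1) k * fleck_quo p a (n + k) 0))
  /\ (exists r : int,
        ord_eq p (fleck_sum (p ^ a) n r) (fleck_exp p a n)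
        /\ ndvdQ p (fleck_quo p a n r))
  /\ ((2 * p ^ a.-1 <= n)%N ->
      forall r : int,
        eqmodQ p (fleck_quo p a (n + p ^ a * (p - 1)) r) (fleck_quo p a n r)).
Proof.
case: a ha hpn => // a _ /= hpn.
have [e [s [lts En]]] := fleck_index hp hpn.
set phi := (p ^ a * (p - 1))%N in lts En.
(* Rows [n] to [n + d0] share the exponent [e], and [n + d0] is the last row with it. *)
pose d0 := (phi - 1 - s)%N.
have exp_const k : (k <= d0)%N -> fleck_exp p a.+1 (n + k) = e.
  by move=> lek; rewrite En -addnA fleck_expE // -/phi; rewrite /d0 in lek; lia.
have quoS k : (k < d0)%N -> forall r, fleck_quo p a.+1 (n + k).+1 r
    = fleck_quo p a.+1 (n + k) r - fleck_quo p a.+1 (n + k) (r - 1).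
  move=> ltk r; apply: fleck_quoS; first by apply: leq_trans hpn _; rewrite leq_addr.
  by rewrite -addnS !exp_const // ltnW.
have top : forall r, exists2 z : int, fleck_quo p a.+1 (n + d0) r = z%:~R
                                     & z%:~R = 1 :> 'F_p.
  move=> r; have Etop : (n + d0 = p ^ a + phi * e + (phi - 1))%N by rewrite En /d0; lia.
  have [|z Cz z1] := fleck_sum_top p a (n + d0) e r hp.
    by rewrite Etop mulnS; lia.
  exists z => //; rewrite Etop; apply: fleck_quoE; rewrite // -/phi -?Etop //; lia.
(* Integer representatives of the quotients, so that congruences can be read in ['F_p]. *)
pose F m r : int := numq (fleck_quo p a.+1 m r).
have FE m r : (p ^ a <= m)%N -> fleck_quo p a.+1 m r = (F m r)%:~R.
  by move=> /(fleck_quo_int _ _ _ r hp)/intrP[z zE]; rewrite /F zE numq_int.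
have le_nD k : (p ^ a <= n + k)%N by rewrite (leq_trans hpn) ?leq_addr.
have FS k : (k < d0)%N -> forall r, F (n + k).+1 r = F (n + k)%N r - F (n + k)%N (r - 1).
  move=> ltk r; apply: (@intr_inj rat); rewrite rmorphB /= -!FE ?quoS //.
  by rewrite -addnS.
have Ftop r : (F (n + d0)%N r)%:~R = 1 :> 'F_p.
  by have [z] := top r; rewrite /F => ->; rewrite numq_int.
split; [|split].
- move=> r d; rewrite totient_expS // -/phi => Ed.
  have {d Ed}-> : d = d0.
    apply/eqP; rewrite -eqz_nat; apply/eqP; rewrite Ed.
    have -> : (p ^ a)%N%:Z - 1 - n%:Z = (- e.+1%:Z) * phi%:Z + d0%:Z.
      by rewrite En /d0 !PoszD PoszM -subzn ?subn_gt0 -?subzn; lia.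
    by rewrite modzMDl modz_nat modn_small // /d0; lia.
  pose b r k : int := numq (gbinom (r%:~R + k%:R - 1) k).
  have bE r' k : (b r' k)%:~R = gbinom (r'%:~R + k%:R - 1) k.
    have /intrP[z zE] := gbinom_int (r' + k%:Z - 1) k.
    by move: zE; rewrite /b rmorphB rmorphD /= => ->; rewrite numq_int.
  exists (F n r), (\sum_(0 <= k < d0.+1) b r k * F (n + k)%N 0); split.
  + exact: FE.
  + rewrite rmorph_sum /=; apply: eq_bigr => k _.
    by rewrite rmorphM /= bE FE.
  apply: eqz_mod_Fp => //; rewrite rmorph_sum /=.
  under eq_bigr do rewrite rmorphM /=.
  apply: (backward_difference_expansion _ (fun m r => (F m r)%:~R)).
  + by move=> r'; rewrite /b /gbinom big_ord0 divr1.
  (* At [r = 0] the coefficient is [k] choose [k + 1]. *)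
  + move=> k; apply: (@intr_inj rat); rewrite bE.
    by rewrite add0r -natr1 addrK gbinom_nat_lt.
  + move=> r' k; apply: (@intr_inj rat); rewrite rmorphD /= !bE rmorphB /=.
    have -> : r'%:~R + k.+1%:R - 1 = (r'%:~R + k%:R - 1) + 1 :> rat.
      by rewrite -natr1; ring.
    by rewrite gbinom_pascal -natr1; congr (gbinom _ _ + _); ring.
  + by move=> k ltk r'; rewrite FS // rmorphB.
  + by move=> r'; rewrite !Ftop.
- have [r Fr] : exists r, (F n r)%:~R != 0 :> 'F_p.
    (* Descent from the last row: if [F] is nonzero modulo [p] at [r] in one row, then in the row
       before it is nonzero at [r] or at [r - 1]. *)
    have : forall j, (j <= d0)%N -> exists r, (F (n + (d0 - j))%N r)%:~R != 0 :> 'F_p.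
      elim=> [|j IHj] ltj; first by exists 0; rewrite subn0 Ftop oner_neq0.
      have [r] := IHj (ltnW ltj).
      have -> : (n + (d0 - j) = (n + (d0 - j.+1)).+1)%N by lia.
      rewrite FS; last by lia.
      have [F0|] := eqVneq ((F (n + (d0 - j.+1))%N r)%:~R : 'F_p) 0; last by exists r.
      by rewrite rmorphB /= F0 sub0r oppr_eq0; exists (r - 1).
    by move=> /(_ d0 (leqnn _)); rewrite subnn addn0.
  have ndvd : ~~ (p%:Z %| F n r)%Z by rewrite (dvdz_pcharf (pchar_Fp hp)).
  exists r; split; last by exists (F n r); rewrite ?FE.
  have [z Cz] := fleck_sum_integral p a e s r hp.
  have Fz : F n r = z.
    by apply: (@intr_inj rat); rewrite -FE // En; apply: fleck_quoE.
  have F0 : F n r != 0 by apply: contraNneq ndvd => ->; rewrite dvdz0.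
  rewrite -/phi -En in Cz; rewrite /ord_eq Cz -Fz; split.
    by rewrite mulf_neq0 // expf_neq0 // oppr_eq0 eqz_nat -lt0n prime_gt0.
  have := exp_const 0%N isT; rewrite addn0 => ->.
  rewrite abszM abszX abszN absz_nat lognM ?absz_gt0 ?expn_gt0 ?prime_gt0 //.
  by rewrite pfactorK // lognE hp absz_gt0 F0 /= [(_ %| _)%N](negbTE ndvd) addn0.
move=> le2 r; rewrite /phi in En lts; rewrite En in le2 *.
have [z [z' [Cz Cz' zz']]] := fleck_sum_period p a e s r hp lts le2.
exists z', z; split; [|exact: fleck_quoE|exact: eqz_mod_Fp].
move: Cz'; have -> : (p ^ a + p ^ a * (p - 1) * e + s + p ^ a.+1 * (p - 1)
  = p ^ a + p ^ a * (p - 1) * (e + p) + s)%N by rewrite expnSr; nia.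
exact: fleck_quoE.
Qed.
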